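(* Let $\beta\in\mathbb{C}$ with $|\beta|>1$, and let $A\subset\mathbb{Q}(\beta)$ be a finite alphabet containing $0$. Suppose that either (1) $\beta$ is real and $\beta$ or $-\beta$ is a Pisot number, or (2) $\beta\in\mathbb{C}\setminus\mathbb{R}$ is a complex Pisot number. Then the spectrum $S_A(\beta)$ has no accumulation point (in $\mathbb{C}$).
   Context: The $A$-spectrum of $\beta$ is $S_A(\beta)=\{\sum_{k=0}^n a_k\beta^k \mid n\in\mathbb{N},\ a_k\in A\}$, where $\mathbb{N}=\{0,1,2,\dots\}$. A point $s\in\mathbb{C}$ is an accumulation point of a set $X\subset\mathbb{C}$ if every neighbourhood of $s$ contains infinitely many elements of $X$. A Pisot number is a real algebraic integer greater than $1$ all of whose other Galois conjugates have modulus less than $1$. A complex Pisot number is an algebraic integer $\beta$ with $|\beta|>1$ such that all its Galois conjugates other than $\beta$ itself and its complex conjugate $\overline{\beta}$ have modulus less than $1$. *)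

(* Defs.v *)
From HB Require Import structures.
From mathcomp Require Import all_boot all_order all_algebra.
From mathcomp Require Import complex.
From mathcomp Require Import all_classical all_reals all_analysis.

Set Implicit Arguments.
Unset Strict Implicit.
Unset Printing Implicit Defensive.

Import Order.TTheory GRing.Theory Num.Theory.
Import numFieldNormedType.Exports.

Local Open Scope classical_set_scope.
Local Open Scope ring_scope.

(* The complex numbers are [R[i]] for [R : realType].  The norm of [R[i]] takes
   its values in [R[i]] itself, where [x < y] entails that [y - x] is real, so
   [1 < b] says that [b] is a real number greater than 1. *)

Definition minimal_polynomial (R : realType) (b : R[i]) (p : {poly rat}) : Prop :=
  [/\ p \is monic, irreducible_poly p & root (map_poly ratr p) b].

Definition galois_conjugate (R : realType) (b z : R[i]) : Prop :=
  exists2 p : {poly rat}, minimal_polynomial b p & root (map_poly ratr p) z.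

Definition algebraic_integer (R : realType) (b : R[i]) : Prop :=
  integralOver (intr : int -> R[i]) b.

Definition pisot (R : realType) (b : R[i]) : Prop :=
  [/\ algebraic_integer b, 1 < b &
      forall z : R[i], galois_conjugate b z -> z != b -> `|z| < 1].

Definition complex_pisot (R : realType) (b : R[i]) : Prop :=
  [/\ algebraic_integer b, 1 < `|b| &
      forall z : R[i], galois_conjugate b z -> z != b -> z != Num.conj b ->
        `|z| < 1].

(* A subset of the field [R[i]] is a subfield iff it contains 1 and is closed
   under subtraction and division ([x / 0] being 0). *)
Definition subfield_set (R : realType) (K : set R[i]) : Prop :=
  GRing.divring_closed (mem K).

Definition Q_adjoin (R : realType) (b : R[i]) : set R[i] :=
  smallest (@subfield_set R) (range (ratr : rat -> R[i]) `|` [set b]).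

Definition spectrum (R : realType) (A : set R[i]) (b : R[i]) : set R[i] :=
  [set z | exists n : nat, exists2 a : nat -> R[i],
     (forall k, (k <= n)%N -> A (a k)) & z = \sum_(0 <= k < n.+1) a k * b ^+ k].

(* [limit_point] only asks each neighbourhood for one point other than [s]. *)
Definition accumulation_point (T : topologicalType) (X : set T) (s : T) : Prop :=
  forall U : set T, nbhs s U -> infinite_set (U `&` X).

(* Main.v *)
(** Clearing denominators, the difference of two distinct points of the spectrum
    is Q(b)/N, where the integer N depends only on A and b, and Q is an integer
    polynomial.  At a conjugate z of modulus less than 1, |Q(z)| is bounded by a
    geometric series independent of the two points, while at the complex
    conjugate of b, |Q| takes the same value as at b.  The product of Q(z) over
    all conjugates z of b is a nonzero integer, so |Q(b)| is bounded below: the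
    spectrum is uniformly discrete.  When -b is Pisot, the spectrum is contained
    in that of -b for the alphabet A U -A. *)

Require Import Defs.
From HB Require Import structures.
From mathcomp Require Import all_boot all_order all_algebra.
From mathcomp Require Import complex.
From mathcomp Require Import all_classical all_reals all_analysis.

Set Implicit Arguments.
Unset Strict Implicit.
Unset Printing Implicit Defensive.

Import Order.TTheory GRing.Theory Num.Theory.
Import numFieldNormedType.Exports.

Local Open Scope classical_set_scope.
Local Open Scope ring_scope.

(** * Embeddings of coefficients, and determinants of matrix polynomials *)

Local Notation pZtoQ := (map_poly (intr : int -> rat)).
Local Notation pZto C := (map_poly (intr : int -> C)).
Local Notation pQto C := (map_poly (ratr : rat -> C)).

(** Over a closed field [q] splits into linear factors, and multiplicativity of the determinant
    leaves only the matrices [A - y%:M], whose determinants are the values of the characteristic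
    polynomial up to sign. *)
Lemma det_horner_mx (F : closedFieldType) n (A : 'M[F]_n.+1) (rs : seq F)
    (q : {poly F}) :
  char_poly A = \prod_(x <- rs) ('X - x%:P) ->
  \det (horner_mx A q) = \prod_(x <- rs) q.[x].
Proof.
move=> charA.
have size_rs : size rs = n.+1.
  by have := size_char_poly A; rewrite charA size_prod_XsubC => -[].
have det_sub y : \det (A - y%:M) = \prod_(x <- rs) (x - y).
  have -> : A - y%:M = - (y%:M - A) by rewrite opprB.
  rewrite -scaleN1r detZ.
  have -> : \det (y%:M - A) = (char_poly A).[y].
    rewrite /char_poly -horner_evalE -det_map_mx; congr (\det _).
    apply/matrixP=> i j.
    by rewrite !mxE rmorphB rmorphMn /= /horner_eval hornerX hornerC.
  (* The sign is spread over the roots, turning each [y - x] into [x - y]. *)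
  have -> : (-1) ^+ n.+1 = \prod_(x <- rs) (-1 : F).
    by rewrite big_const_seq count_predT size_rs iter_mulr_1.
  rewrite charA horner_prod -big_split.
  by apply: eq_bigr => x _; rewrite /= hornerXsubC mulN1r opprB.
have [ys ->] := closed_field_poly_normal q.
rewrite linearZ detZ /= rmorph_prod /=.
rewrite (eq_bigr (fun x => lead_coef q * \prod_(y <- ys) (x - y))); last first.
  move=> x _; rewrite hornerZ horner_prod; congr (_ * _).
  by apply: eq_bigr => y _; rewrite !hornerE.
rewrite big_split /= big_const_seq count_predT size_rs iter_mulr_1.
congr (_ * _); rewrite exchange_big /=.
elim: ys => [|y ys IH]; first by rewrite !big_nil det1.
rewrite !big_cons det_mulmx IH; congr (_ * _).
by rewrite rmorphB /= horner_mx_X horner_mx_C det_sub.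
Qed.

(** * Integer minimal polynomials and norms *)

Lemma pQto_pZtoQ (C : numFieldType) (p : {poly int}) :
  pQto C (pZtoQ p) = pZto C p.
Proof. by rewrite -map_poly_comp; apply: eq_map_poly => x /=; rewrite ratr_int. Qed.

(** Otherwise [p] and [q] are coprime, and a Bezout relation evaluated at [x] reads 0 = 1. *)
Lemma irreducible_common_root (C : numFieldType) (p q : {poly rat}) (x : C) :
  irreducible_poly p -> root (pQto C p) x -> root (pQto C q) x -> p %| q.
Proof.
move=> irr px qx; apply/negPn; rewrite -irreducible_poly_coprime //.
apply/negP => /Bezout_eq1_coprimepP[[u v] /= e].
have := congr1 (fun r => (pQto C r).[x]) e.
rewrite rmorphD !rmorphM /= rmorph1 !hornerE.
by rewrite (rootP px) (rootP qx) !mulr0 addr0 => /esym/eqP; rewrite oner_eq0.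
Qed.

(** A nonzero rational polynomial of least degree vanishing at [b] is irreducible; Gauss's lemma,
    applied to its divisibility of a monic integer polynomial, makes it proportional to a monic
    integer one. *)
Lemma integral_minimal_polynomial (C : numFieldType) (b : C) :
  integralOver (intr : int -> C) b ->
  exists p : {poly int},
    [/\ p \is monic, irreducible_poly (pZtoQ p) & root (pZto C p) b].
Proof.
case=> p0 p0_monic p0b.
pose P n := `[< exists q : {poly rat}, [/\ q != 0, root (pQto C q) b & size q = n] >].
have exP : exists n, P n.
  exists (size (pZtoQ p0)); apply/asboolP; exists (pZtoQ p0); split => //.
    by rewrite monic_neq0 ?monic_map.
  by rewrite pQto_pZtoQ.
case: (ex_minnP exP) => n /asboolP[q [q0 qb <-]] minq {exP n}.
have {}minq r : r != 0 -> root (pQto C r) b -> (size q <= size r)%N.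
  by move=> r0 rb; apply: minq; apply/asboolP; exists r.
have irrq : irreducible_poly q.
  split.
    rewrite ltnNge; apply/negP => sq; move: qb q0.
    rewrite (size1_polyC sq) map_polyC /= rootC fmorph_eq0 => /eqP ->.
    by rewrite eqxx.
  move=> d sd /dvdpP[e qE]; have e0 : e != 0.
    by apply: contraNneq q0 => e0; rewrite qE e0 mul0r.
  have d0 : d != 0.
    by apply: contraNneq q0 => d0; rewrite qE d0 mulr0.
  have dq : d %| q by rewrite qE dvdp_mull.
  rewrite -dvdp_size_eqp // eqn_leq dvdp_leq //=.
  move: qb; rewrite qE rmorphM /= rootM => /orP[eb | db]; last first.
    by rewrite -qE minq.
  (* As [d] is not constant, [e] is smaller than [q], against minimality. *)
  have := minq _ e0 eb; rewrite qE size_mul //.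
  have : (0 < size d)%N by rewrite size_poly_gt0.
  by case: (size d) sd => [|[|m]] // _ _; rewrite !addnS /= ltnNge leq_addr.
have : q %| pZtoQ p0.
  by apply: irreducible_common_root qb _ => //; rewrite pQto_pZtoQ.
case/dvdpP_rat_int => p1 [a a0 qE] [r p0E].
(* Since [p0] is [p1 * r] over the integers, both leading coefficients are units, and scaling by
   that of [r] makes [p1] monic. *)
have u1 : lead_coef p1 * lead_coef r = 1.
  by rewrite -lead_coefM -p0E; apply/monicP.
exists (lead_coef r *: p1); split.
- by rewrite monicE lead_coefZ mulrC u1.
- have r0 : (lead_coef r)%:~R != 0 :> rat.
    by rewrite intr_eq0; apply: contra_eq_neq u1 => ->; rewrite mulr0.
  have eqq : pZtoQ (lead_coef r *: p1) %= q.
    rewrite linearZ /= qE (eqp_trans (eqp_scale _ r0)) //.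
    by rewrite eqp_sym eqp_scale.
  case: irrq => sq irr; split; first by rewrite (eqp_size eqq).
  move=> d sd dv; apply: eqp_trans (_ : _ %= q) _; last by rewrite eqp_sym.
  by apply: irr => //; rewrite -(eqp_dvdr _ eqq).
- move: qb; rewrite qE linearZ /= pQto_pZtoQ linearZ /= !rootE !hornerZ.
  rewrite mulf_eq0 fmorph_eq0 (negPf a0) /= => /eqP ->.
  by rewrite mulr0.
Qed.

Lemma prod_conjugates_ge1 (C : numClosedFieldType) (p q : {poly int})
    (rs : seq C) (b : C) :
  p \is monic -> irreducible_poly (pZtoQ p) ->
  pZto C p = \prod_(x <- rs) ('X - x%:P) ->
  b \in rs -> (pZto C q).[b] != 0 -> 1 <= \prod_(x <- rs) `|(pZto C q).[x]|.
Proof.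
move=> p_monic irr pE b_rs qb0; rewrite -normr_prod.
have p_rs x : x \in rs -> root (pZto C p) x by rewrite pE root_prod_XsubC.
(* The product of the [q.[x]] is the determinant of [q] evaluated at the integer
   companion matrix of [p]. *)
have [n [A charA]] : exists n, exists A : 'M[int]_n.+1, char_poly A = p.
  move: (companionmx p) (companionmxK p_monic).
  (* Irreducibility rules out a constant [p], hence a companion matrix of size 0. *)
  case dE: (size p).-1 => [|n] A AE; last by exists n, A.
  have := irr.1; rewrite size_rat_int_poly.
  by move: dE; case: (size p) => [|[]].
have prodE : \prod_(x <- rs) (pZto C q).[x] = (\det (horner_mx A q))%:~R.
  rewrite -det_map_mx map_horner_mx (@det_horner_mx _ _ _ rs) //.
  by rewrite -map_char_poly charA.
have : \prod_(x <- rs) (pZto C q).[x] != 0.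
  (* If [q] vanished at one root of [p], then [p] would divide [q], and [q] would vanish at [b]
     too. *)
  rewrite prodf_seq_neq0; apply/allP => x x_rs /=.
  apply: contraNneq qb0 => qx0.
  have pq : pZtoQ p %| pZtoQ q.
    apply: (@irreducible_common_root C _ _ x) => //; rewrite pQto_pZtoQ.
      exact: p_rs.
    by rewrite rootE qx0.
  have /dvdpP[r rE] := pq.
  rewrite -pQto_pZtoQ rE rmorphM /= hornerM pQto_pZtoQ.
  by rewrite (rootP (p_rs _ b_rs)) mulr0.
rewrite prodE intr_eq0 => d0.
by rewrite -intr_norm ler1z -gtz0_ge1 normr_gt0.
Qed.

(** * Elements of Q(b) as polynomial values, and common denominators *)

Lemma Q_adjoin_horner (R : realType) (p : {poly rat}) (b : R[i]) :
  irreducible_poly p -> root (pQto R[i] p) b ->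
  Q_adjoin b `<=` range (fun q : {poly rat} => (pQto R[i] q).[b]).
Proof.
move=> irr pb; apply: smallest_sub.
  (* The values at [b] of rational polynomials already form a subfield. *)
  split.
  - by rewrite inE; exists 1; rewrite // rmorph1 hornerC.
  - move=> _ _ /set_mem[q _ <-] /set_mem[r _ <-]; rewrite inE.
    by exists (q - r); rewrite // rmorphB !hornerE.
  - move=> _ _ /set_mem[q _ <-] /set_mem[r _ <-]; rewrite inE.
    (* Division by zero gives 0; otherwise the Bezout cofactor of [r] takes at [b] the value inverse
       to that of [r]. *)
    have [rb|rb] := boolP (root (pQto R[i] r) b).
      by exists 0; rewrite // (rootP rb) invr0 mulr0 rmorph0 horner0.
    have : coprimep p r.
      rewrite irreducible_poly_coprime //; apply: contra rb => /dvdpP[s ->].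
      by rewrite rmorphM /= rootM pb orbT.
    move=> /Bezout_eq1_coprimepP[[u v] /= e].
    have := congr1 (fun r => (pQto R[i] r).[b]) e.
    rewrite rmorphD !rmorphM /= rmorph1 !hornerE (rootP pb) mulr0 add0r => e1.
    exists (q * v) => //.
    by rewrite rmorphM /= hornerM; congr (_ * _); apply: (mulIf rb); rewrite e1 mulVf.
move=> _ [[q _ <-]|->].
  by exists q%:P; rewrite // map_polyC hornerC.
by exists 'X; rewrite // map_polyX hornerX.
Qed.

Lemma common_denominator (C : numFieldType) (b : C) (s : seq C) :
  {in s, forall x, exists q : {poly rat}, x = (pQto C q).[b]} ->
  exists2 N : int, N != 0 &
    {in s, forall x, exists P : {poly int}, N%:~R * x = (pZto C P).[b]}.
Proof.
elim: s => [_|x s IH xs]; first by exists 1.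
have [|N N0 HN] := IH; first by move=> y ys; apply: xs; rewrite inE ys orbT.
have [q xE] := xs _ (mem_head x s).
have [q' [a a0 qE]] := rat_poly_scale q.
exists (N * a) => [|y]; first by rewrite mulf_neq0.
rewrite inE intrM => /predU1P[->|/HN[P NyE]].
  exists (N *: q'); rewrite linearZ /= hornerZ -mulrA; congr (_ * _).
  rewrite xE qE linearZ /= hornerZ pQto_pZtoQ fmorphV rmorph_int mulrA mulfV ?mul1r//.
  by rewrite intr_eq0.
by exists (a *: P); rewrite linearZ /= hornerZ -NyE mulrA [a%:~R * _]mulrC.
Qed.

(** * Bounds at conjugates inside the unit disc *)

Lemma ler_sum_mem (C : numDomainType) (I : eqType) (s : seq I) (F : I -> C) x :
  (forall i, 0 <= F i) -> x \in s -> F x <= \sum_(i <- s) F i.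
Proof. by move=> F0 xs; rewrite (big_rem x) //= lerDl sumr_ge0. Qed.

Lemma norm_power_sum_le (C : numFieldType) (M z : C) (c : nat -> C) n :
  0 <= M -> (forall k, (k < n)%N -> `|c k| <= M) -> `|z| < 1 ->
  `|\sum_(0 <= k < n) c k * z ^+ k| <= M / (1 - `|z|).
Proof.
move=> M0 cM z1; have z1' : 0 < 1 - `|z| by rewrite subr_gt0.
apply: le_trans (ler_norm_sum _ _ _) _.
rewrite ler_pdivlMr //.
apply: (@le_trans _ _ (M * (\sum_(0 <= k < n) `|z| ^+ k) * (1 - `|z|))).
  rewrite ler_wpM2r ?(ltW z1') // mulr_sumr big_seq [leRHS]big_seq.
  apply: ler_sum => k; rewrite mem_index_iota /= => kn.
  by rewrite normrM normrX ler_wpM2r ?exprn_ge0 ?cM.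
(* The geometric sum telescopes against [1 - |z|]. *)
rewrite -mulrA mulrC [X in X * M](_ : _ = 1 - `|z| ^+ n); last first.
  by rewrite -opprB -[RHS]opprB subrX1 big_mkord mulrN mulrC.
by rewrite ler_piMl // lerBlDr lerDl exprn_ge0.
Qed.

Lemma horner_digit_polynomial (C : numFieldType) (P : nat -> {poly int}) n (z : C) :
  (pZto C (\sum_(0 <= k < n) P k * 'X^k)).[z] =
  \sum_(0 <= k < n) (pZto C (P k)).[z] * z ^+ k.
Proof.
rewrite rmorph_sum horner_sum; apply: eq_bigr => k _ /=.
by rewrite rmorphM /= map_polyXn hornerM hornerXn.
Qed.

(** The bound must not depend on the length or choice of the digit string. Sums over the finite
    lists [s] and [rs] stand in for maxima, as the order on [C] is only partial. *)
Lemma digit_polynomial_bound (C : numFieldType) (s rs : seq C)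
    (P : C -> {poly int}) :
  exists2 M : C, 1 <= M & forall n (a : nat -> C) (z : C),
    (forall k, (k < n)%N -> a k \in s) -> z \in rs -> `|z| < 1 ->
    `|(pZto C (\sum_(0 <= k < n) P (a k) * 'X^k)).[z]| <= M.
Proof.
pose T z := \sum_(x <- s) `|(pZto C (P x)).[z]|.
(* Outside the open disc the geometric bound is meaningless; 0 keeps every term nonnegative. *)
pose F z := if `|z| < 1 then T z / (1 - `|z|) else 0.
have T0 z : 0 <= T z by apply: sumr_ge0.
have F0 z : 0 <= F z.
  by rewrite /F; case: ifP => // z1; rewrite divr_ge0 // subr_ge0 ltW.
(* The summand 1 serves later, where [M + M] must also bound factors of modulus at most 1. *)
exists (1 + \sum_(z <- rs) F z); first by rewrite lerDl sumr_ge0.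
move=> n a z as_ zrs z1; rewrite horner_digit_polynomial.
apply: le_trans (_ : F z <= _); last first.
  by apply: le_trans (ler_sum_mem F0 zrs) _; rewrite lerDr.
rewrite /F z1; apply: norm_power_sum_le => // k kn.
by apply: (ler_sum_mem (F := fun x => `|(pZto C (P x)).[z]|)) => //; exact: as_.
Qed.

(** * Uniform discreteness of the spectrum *)

Lemma horner_int_conj (C : numClosedFieldType) (q : {poly int}) (x : C) :
  (pZto C q).[Num.conj x] = Num.conj (pZto C q).[x].
Proof.
rewrite -horner_map -map_poly_comp; congr (_.[_]).
by apply: eq_map_poly => m /=; rewrite rmorph_int.
Qed.

Lemma spectrum_uniformly_discrete (R : realType) (b : R[i]) (A : set R[i]) :
  complex_pisot b -> finite_set A -> A `<=` Q_adjoin b ->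
  exists2 d : R[i], 0 < d & forall x y, spectrum A b x -> spectrum A b y ->
    x != y -> d <= `|x - y|.
Proof.
case=> b_int b1 b_conj /finite_seqP[s sA] AQ.
have [p [p_monic p_irr pb]] := integral_minimal_polynomial b_int.
have [N N0 HN] : exists2 N : int, N != 0 &
    {in s, forall x, exists P : {poly int}, N%:~R * x = (pZto R[i] P).[b]}.
  apply: common_denominator => x xs.
  have /(Q_adjoin_horner p_irr)[|q _ <-] : Q_adjoin b x by apply: AQ; rewrite sA.
    by rewrite pQto_pZtoQ.
  by exists q.
have [P HP] : exists P : R[i] -> {poly int},
    forall x, x \in s -> N%:~R * x = (pZto R[i] (P x)).[b].
  suff /choice[P HP] : forall x, exists Px : {poly int},
      x \in s -> N%:~R * x = (pZto R[i] Px).[b] by exists P.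
  (* Outside the alphabet the polynomial 0 makes the choice total. *)
  move=> x; have [/HN[q Hq]|_] := boolP (x \in s); last by exists 0.
  by exists q.
have [rs pE] := closed_field_poly_normal (pZto R[i] p).
rewrite (monicP (monic_map _ p_monic)) scale1r in pE.
have b_rs : b \in rs by rewrite -root_prod_XsubC -pE.
have rs_conj z : z \in rs -> z != b -> z != Num.conj b -> `|z| < 1.
  move=> z_rs; apply: b_conj; exists (pZtoQ p); first split.
  - exact: monic_map.
  - exact: p_irr.
  - by rewrite pQto_pZtoQ.
  - by rewrite pQto_pZtoQ pE root_prod_XsubC.
have [M M1 HM] := digit_polynomial_bound s rs P.
have specP x : spectrum A b x -> exists2 Q : {poly int},
    N%:~R * x = (pZto R[i] Q).[b] &
    forall z, z \in rs -> `|z| < 1 -> `|(pZto R[i] Q).[z]| <= M.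
  case=> n [a aA ->].
  have as_ k : (k < n.+1)%N -> a k \in s.
    by move=> /aA; rewrite sA.
  exists (\sum_(0 <= k < n.+1) P (a k) * 'X^k) => [|z z_rs z1].
    rewrite horner_digit_polynomial mulr_sumr; apply: eq_big_nat => k /= kn.
    by rewrite -HP ?as_ // mulrA.
  exact: HM.
have N_gt0 : 0 < `|N%:~R| :> R[i] by rewrite normr_gt0 intr_eq0.
(* A difference of two digit polynomials is at most [M + M] at each small conjugate; [D] bounds the
   product of all factors but the one at [b]. *)
pose D := (M + M) ^+ size rs.
have MM1 : 1 <= M + M by rewrite (le_trans M1) // lerDl (le_trans ler01).
have MM0 : 0 <= M + M by rewrite (le_trans ler01).
have D1 : 1 <= D by rewrite exprn_ege1.
have D0 : 0 < D by rewrite (lt_le_trans ltr01).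
exists (D * `|N%:~R|)^-1; first by rewrite invr_gt0 mulr_gt0.
move=> x y /specP[Qx xE Qx_le] /specP[Qy yE Qy_le] xy.
pose Q := Qx - Qy.
have QE z : (pZto R[i] Q).[z] = (pZto R[i] Qx).[z] - (pZto R[i] Qy).[z].
  by rewrite rmorphB !hornerE.
have Qb : (pZto R[i] Q).[b] = N%:~R * (x - y) by rewrite QE -xE -yE mulrBr.
have Qb0 : (pZto R[i] Q).[b] != 0.
  by rewrite Qb mulf_neq0 ?intr_eq0 // subr_eq0.
suff : 1 <= D * `|(pZto R[i] Q).[b]|.
  by rewrite Qb normrM mulrA -ler_pdivrMl ?mulr_gt0 // mulr1.
(* The factors at [b] and its conjugate may only be bounded by [M + M] when
   [`|Q.[b]| <= 1]; otherwise the claim is immediate. *)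
have [Qb_le1|Qb_gt1] := real_leP (normr_real (pZto R[i] Q).[b]) (real1 _); last first.
  by rewrite mulr_ege1 // ltW.
have factor_le z : z \in rs -> `|(pZto R[i] Q).[z]| <= M + M.
  move=> z_rs; have [->|zb] := eqVneq z b; first exact: le_trans MM1.
  have [->|zcb] := eqVneq z (Num.conj b).
    by rewrite horner_int_conj norm_conjC; exact: le_trans MM1.
  by rewrite QE (le_trans (ler_normB _ _)) // lerD ?Qx_le ?Qy_le ?rs_conj.
apply: le_trans (prod_conjugates_ge1 p_monic p_irr pE b_rs Qb0) _.
rewrite (big_rem b) //= mulrC ler_wpM2r //.
apply: le_trans (_ : \prod_(z <- rem b rs) (M + M) <= _).
  rewrite [leLHS]big_seq [leRHS]big_seq.
  apply: ler_prod => z => /mem_rem z_rs.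
  by rewrite normr_ge0 factor_le.
rewrite big_const_seq count_predT iter_mulr_1 size_rem //.
(* Only [(size rs).-1] factors remain; the larger exponent in [D] is harmless because [M + M] is at
   least 1. *)
by rewrite ler_weXn2l // leq_pred.
Qed.

(** * Reduction of the cases and absence of accumulation points *)

Lemma pisot_complex_pisot (R : realType) (b : R[i]) : pisot b -> complex_pisot b.
Proof.
case=> b_int b1 b_conj; split=> // [|z bz zb _]; last exact: b_conj.
by rewrite ger0_norm // (le_trans ler01) // ltW.
Qed.

Lemma Q_adjoinN (R : realType) (b : R[i]) : Q_adjoin b `<=` Q_adjoin (- b).
Proof.
move=> x xb K [K_sub K_gen]; apply: xb; split=> // y [Kq|->].
  by apply: K_gen; left.
have [K1 KB _] := K_sub.
have Kb : - b \in mem K by rewrite inE; apply: K_gen; right.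
have K0 : 0 \in mem K by rewrite -(subrr 1) KB.
by have := KB _ _ K0 Kb; rewrite opprK add0r inE.
Qed.

Lemma Q_adjoin_opp (R : realType) (b x : R[i]) : Q_adjoin b x -> Q_adjoin b (- x).
Proof.
move=> xb K K_sub; have [[K1 KB _] _] := K_sub.
have K0 : 0 \in mem K by rewrite -(subrr 1) KB.
have Kx : x \in mem K by rewrite inE; exact: xb.
by have := KB _ _ K0 Kx; rewrite add0r inE.
Qed.

Lemma spectrumN (R : realType) (A : set R[i]) (b : R[i]) :
  spectrum A b `<=` spectrum (A `|` -%R @` A) (- b).
Proof.
(* The digits absorb the signs of the powers of [- b]. *)
move=> _ [n [a aA ->]]; exists n; exists (fun k => (-1) ^+ k * a k).
  move=> k /aA Aak; rewrite -signr_odd; case: (odd k).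
    by right; exists (a k); rewrite // expr1 mulN1r.
  by left; rewrite expr0 mul1r.
apply: eq_bigr => k _; rewrite [(- b) ^+ k]exprNn mulrACA -exprD addnn.
by rewrite -signr_odd odd_double expr0 mul1r.
Qed.

(** Two points in a ball of radius [d / 2] are less than [d] apart, so such a ball contains at most
    one point of [X]. *)
Lemma uniformly_discrete_no_accumulation (R : realType) (X : set R[i]^o) (d : R[i]) :
  0 < d -> (forall x y, X x -> X y -> x != y -> d <= `|x - y|) ->
  ~ exists s : R[i]^o, accumulation_point X s.
Proof.
move=> d0 X_sep [s s_acc].
have d20 : 0 < d / 2 by rewrite divr_gt0.
apply: (s_acc (ball s (d / 2))); first exact: nbhsx_ballx.
have [[x0 [sx0 Xx0]]|no_pt] := pselect (exists x, (ball s (d / 2) `&` X) x).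
  apply: (sub_finite_set _ (finite_set1 x0)) => y [sy Xy] /=.
  apply/eqP/negPn/negP => yx0.
  have := X_sep _ _ Xy Xx0 yx0; apply/negP; rewrite lt_geF //.
  move: sx0 sy; rewrite -ball_normE /ball_ /= => sx0 sy.
  rewrite -(subrKA s) (splitr d) (le_lt_trans (ler_normD _ _)) // ltrD //.
  by rewrite distrC.
apply: (sub_finite_set _ (finite_set0 _)) => y Uy.
by apply: no_pt; exists y.
Qed.

(* [R[i]^o] is [R[i]] with the topology of its norm. *)
Theorem theorem3p6 (R : realType) (b : R[i]) (A : set R[i])
    (b_gt1 : 1 < `|b|)
    (finA : finite_set A) (A0 : A 0) (AQb : A `<=` Q_adjoin b)
    (hb : (b \is Num.real /\ (pisot b \/ pisot (- b)))
          \/ (b \isn't Num.real /\ complex_pisot b)) :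
  ~ exists s : R[i]^o, accumulation_point (spectrum A b : set R[i]^o) s.
Proof.
suff [d d0 sep] : exists2 d : R[i], 0 < d &
    forall x y, spectrum A b x -> spectrum A b y -> x != y -> d <= `|x - y|.
  exact: uniformly_discrete_no_accumulation d0 sep.
(* [complex_pisot] admits real numbers, so it covers a Pisot [b] together with the non-real case. *)
have [b_cpisot|Nb_pisot] : complex_pisot b \/ pisot (- b).
  case: hb => [[_ [/pisot_complex_pisot|]]|[_]]; by [left|right].
  exact: spectrum_uniformly_discrete.
have [|||d d0 sep] :=
  @spectrum_uniformly_discrete R (- b) (A `|` -%R @` A).
- exact: pisot_complex_pisot.
- by rewrite finite_setU; split=> //; exact: finite_image.
- by move=> _ [/AQb/Q_adjoinN //|[x /AQb/Q_adjoinN xb <-]]; exact: Q_adjoin_opp.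
by exists d => // x y /spectrumN xS /spectrumN; exact: sep.
Qed.
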